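(* No randomized strategyproof mechanism for locating an obnoxious facility on $[0,1]$ has an approximation ratio better than $(5/4)^{1/p}$ for the $L_p$ social cost, for any $1\le p<\infty$. No randomized strategyproof mechanism has an approximation ratio better than $1.008$ for the $L_\infty$ social cost.
   Context: Agents $i=1,\dots,n$ have private locations $x_i\in[0,1]$. A randomized mechanism maps each reported profile to a distribution over $[0,1]$; agent $i$'s cost from a distribution $\pi$ is $\mathbb E_{y\sim\pi}[1-|x_i-y|]$, and the mechanism is strategyproof if no agent can decrease its expected cost by misreporting, holding others' reports fixed. $L_p$ social cost: $\mathrm{sc}_p(y,\mathbf x)=(\sum_i(1-|x_i-y|)^p)^{1/p}$, $\mathrm{sc}_\infty(y,\mathbf x)=\max_i(1-|x_i-y|)$; the mechanism's value is $\mathbb E_{y\sim f(\mathbf x)}[\mathrm{sc}_p(y,\mathbf x)]$. Approximation ratio: supremum over all numbers of agents and profiles of the mechanism's value divided by $\min_{z\in[0,1]}\mathrm{sc}_p(z,\mathbf x)$. *)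

(* Defs.v *)
From HB Require Import structures.
From mathcomp Require Import all_boot all_order all_algebra.
From mathcomp Require Import all_classical all_reals all_analysis.
Set Implicit Arguments. Unset Strict Implicit. Unset Printing Implicit Defensive.
Import Order.TTheory GRing.Theory Num.Theory.
Local Open Scope classical_set_scope.
Local Open Scope ring_scope.

Definition mechanism (R : realType) :=
  forall n : nat, ('I_n -> R) -> probability R R.

Definition profile_in01 (R : realType) n (x : 'I_n -> R) :=
  forall i, x i \in `[0, 1].

Definition valid_mechanism (R : realType) (f : mechanism R) :=
  forall n (x : 'I_n -> R), profile_in01 x -> f n x `[0, 1]%classic = 1%E.

Definition upd (R : realType) n (x : 'I_n -> R) (i : 'I_n) (y : R) : 'I_n -> R :=
  fun j => if j == i then y else x j.

Definition closeness (R : realType) (a y : R) : R := 1 - `|a - y|.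

Definition exp_cost (R : realType) (P : probability R R) (a : R) : \bar R :=
  (\int[P]_(y in `[0%R, 1%R]%classic) (closeness a y)%:E)%E.

Definition strategyproof (R : realType) (f : mechanism R) :=
  forall n (x : 'I_n -> R) (i : 'I_n) (y : R),
    profile_in01 x -> y \in `[0, 1] ->
    (exp_cost (f n x) (x i) <= exp_cost (f n (upd x i y)) (x i))%E.

Definition sc_p (R : realType) (p : R) n (y : R) (x : 'I_n -> R) : R :=
  (\sum_(i < n) (closeness (x i) y) `^ p) `^ (p^-1).

(* L_oo social cost (0 for the empty profile) *)
Definition sc_inf (R : realType) n (y : R) (x : 'I_n -> R) : R :=
  \big[Num.max/0]_(i < n) closeness (x i) y.

Definition mech_value (R : realType) (sc : R -> R) (P : probability R R) : \bar R :=
  (\int[P]_(y in `[0%R, 1%R]%classic) (sc y)%:E)%E.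

(* optimal social cost: min over z in [0,1] (attained, sc continuous) *)
Definition opt_cost (R : realType) (sc : R -> R) : R :=
  inf [set sc z | z in `[0, 1]%classic].

Definition ratio_at_least (R : realType) (f : mechanism R)
  (sc : forall n, R -> ('I_n -> R) -> R) (c0 : R) :=
  forall c : R, c < c0 ->
    exists n (x : 'I_n -> R), profile_in01 x /\
      0 < opt_cost (fun z => sc n z x) /\
      ((c * opt_cost (fun z => sc n z x))%:E < mech_value (fun y => sc n y x) (f n x))%E.

(* Main.v *)
Require Import Defs.
From HB Require Import structures.
From mathcomp Require Import all_boot all_order all_algebra.
From mathcomp Require Import all_classical all_reals all_analysis.
From mathcomp Require Import measurable_realfun ring lra.
Set Implicit Arguments. Unset Strict Implicit. Unset Printing Implicit Defensive.
Import Order.TTheory GRing.Theory Num.Theory.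
Local Open Scope ring_scope.

(** For every social cost [sc >= sc_inf] that reduces to the only nonzero
    individual cost, two agents already force ratio 5/4.  Put them at
    [a = 1/2 - h] and [b = 1/2 + h].  Since [|a - y| + |b - y| <= 1], one of
    them, by symmetry the agent at [a], has expected distance at most 1/2, and
    by strategyproofness this persists when it reports 0.  On the profile
    [(0, b)] the expected distance to [b] must be at least about [1 - b], since
    otherwise the agent at [b] would report [h^2], where any bounded ratio
    forces the facility to be near 1.  Meeting both constraints forces
    probability about 1/4 near 0, where the cost is about 1, whereas the
    facility 1 costs only [b].  As [5/4 >= (5/4)^(1/p)], this gives all [p]. *)

(** * Closeness on the unit interval *)

Lemma itv01P (R : realType) (z : R) : reflect (0 <= z <= 1) (z \in `[0, 1]).
Proof. by rewrite in_itv /=; apply: idP. Qed.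

Lemma ord2_neq (i j k : 'I_2) : i != k -> j != k -> i = j.
Proof.
by case: i j k => [[|[|i]] ?] [[|[|j]] ?] [[|[|k]] ?] // _ _; apply: val_inj.
Qed.

Lemma closeness_ge0 (R : realType) (u y : R) :
  u \in `[0, 1] -> y \in `[0, 1] -> 0 <= closeness u y.
Proof.
move=> /itv01P hu /itv01P hy.
by rewrite /closeness subr_ge0 ler_norml; apply/andP; split; lra.
Qed.

(* The linear-programming certificate: in terms of [a = 1/2 - h] and
   [b = 1/2 + h], the left-hand side is
   [b + l * (b - |a - z|) + (l + 1) * (|b - z| - a)], with the multiplier [l]
   chosen so that it equals [closeness 0 z] for all [z <= a]. *)
Lemma max_closeness_lower_bound (R : realType) (h l z : R) :
  0 < h -> h <= 1 / 10 -> l * h = 1 / 8 - 3 / 4 * h -> z \in `[0, 1] ->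
  (1 / 2 + h) + (l + 1) * (1 / 2 + h) - l * (1 / 2 - h)
    + l * closeness (1 / 2 - h) z + - (l + 1) * closeness (1 / 2 + h) z
  <= Num.max (closeness 0 z) (closeness (1 / 2 + h) z).
Proof.
move=> h0 h1 lh /itv01P /andP[z0 z1]; rewrite /closeness.
have l0 : 0 <= l by rewrite -(pmulr_lge0 _ h0) lh; lra.
rewrite le_max; apply/orP.
have -> : `|0 - z| = z by rewrite sub0r normrN ger0_norm.
have [za|az] := leP z (1 / 2 - h).
  left.
  have -> : `|1 / 2 - h - z| = 1 / 2 - h - z by rewrite ger0_norm; lra.
  have -> : `|1 / 2 + h - z| = 1 / 2 + h - z by rewrite ger0_norm; lra.
  lra.
right.
have -> : `|1 / 2 - h - z| = z - (1 / 2 - h) by rewrite ler0_norm; lra.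
have [zb|bz] := leP z (1 / 2 + h).
  have -> : `|1 / 2 + h - z| = 1 / 2 + h - z by rewrite ger0_norm; lra.
  have : 0 <= l * (z - (1 / 2 - h)) by rewrite mulr_ge0 //; lra.
  lra.
have -> : `|1 / 2 + h - z| = z - (1 / 2 + h) by rewrite ler0_norm; lra.
lra.
Qed.

(** * Expected closeness under a distribution *)

(** Real-valued counterpart of [exp_cost], so that the constraints can be combined by linear
    arithmetic. *)
Definition mean_closeness (R : realType) (P : probability R R) (u : R) : R :=
  (\int[P]_(y in `[0, 1]%classic) closeness u y)%R.

Lemma measurable_closeness (R : realType) (D : set R) (u : R) :
  measurable_fun D (closeness u).
Proof.
apply: measurable_funB; first exact: measurable_cst.
apply: measurableT_comp; first exact: normr_measurable.
by apply: measurable_funB; [exact: measurable_cst | exact: measurable_id].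
Qed.

Lemma integrable_closeness (R : realType) (P : probability R R) (u : R) :
  P.-integrable `[0, 1]%classic (EFin \o closeness u).
Proof.
apply: measurable_bounded_integrable => //.
- by apply: (le_lt_trans (probability_le1 _ _)) => //; rewrite ltry.
- exact: measurable_closeness.
exists (2 + `|u|); split; first exact: num_real.
move=> M ltM y /= /itv01P /andP[y0 y1]; apply: le_trans (ltW ltM).
rewrite /closeness (le_trans (ler_normB _ _)) // normr1 normr_id.
by have := ler_normB u y; rewrite (ger0_norm y0); lra.
Qed.

Lemma integrable_closenessZ (R : realType) (P : probability R R) (q u : R) :
  P.-integrable `[0, 1]%classic (EFin \o (fun y => q * closeness u y)).
Proof. exact: (integrableZl _ q (integrable_closeness P u)). Qed.

Lemma exp_costE (R : realType) (P : probability R R) (u : R) :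
  exp_cost P u = (mean_closeness P u)%:E.
Proof.
rewrite /mean_closeness /Rintegral fineK //.
by apply: integrable_fin_num => //; exact: integrable_closeness.
Qed.

Lemma integrable_closeness_comb (R : realType) (P : probability R R)
    (k r t u v : R) :
  P.-integrable `[0, 1]%classic
    (EFin \o (fun y => k + r * closeness u y + t * closeness v y)).
Proof.
apply: (@integrableD _ _ _ _ _ _
  (EFin \o (fun y => k + r * closeness u y)) _ _ (integrable_closenessZ P t v)) => //.
apply: (@integrableD _ _ _ _ _ _ (EFin \o (fun=> k)) _ _ (integrable_closenessZ P r u)) => //.
exact: finite_measure_integrable_cst.
Qed.

Lemma Rintegral_closeness_comb (R : realType) (P : probability R R)
    (k r t u v : R) :
  P `[0, 1]%classic = 1%E ->
  (\int[P]_(y in `[0, 1]%classic) (k + r * closeness u y + t * closeness v y))%R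
  = k + r * mean_closeness P u + t * mean_closeness P v.
Proof.
move=> P1; have ik : P.-integrable `[0, 1]%classic (EFin \o (fun=> k)).
  exact: finite_measure_integrable_cst.
have iZ := integrable_closenessZ P.
rewrite (@RintegralD _ _ _ _ _ (fun y => k + r * closeness u y)) //; last first.
  exact: (@integrableD _ _ _ _ _ _ (EFin \o (fun=> k)) _ ik (iZ r u)).
rewrite RintegralD // !RintegralZl //; try exact: integrable_closeness.
rewrite Rintegral_cst //; congr (_ + _ + _).
by rewrite -[RHS]mulr1; congr (_ * _); exact: (congr1 fine P1).
Qed.

Lemma mean_closeness_comb_ge (R : realType) (P : probability R R)
    (k r t u v : R) :
  P `[0, 1]%classic = 1%E ->
  (forall y, y \in `[0, 1] -> k <= r * closeness u y + t * closeness v y) ->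
  k <= r * mean_closeness P u + t * mean_closeness P v.
Proof.
move=> P1 hk; have := Rintegral_closeness_comb (- k) r t u v P1.
have : 0 <= (\int[P]_(y in `[0, 1]%classic)
    (- k + r * closeness u y + t * closeness v y))%R.
  by apply: Rintegral_ge0 => y /= /hk; lra.
lra.
Qed.

Lemma mech_value_ge (R : realType) (P : probability R R) (sc : R -> R)
    (k r t u v : R) :
  P `[0, 1]%classic = 1%E -> measurable_fun (`[0, 1]%classic : set R) sc ->
  (forall y, y \in `[0, 1] -> 0 <= sc y) ->
  (forall y, y \in `[0, 1] ->
     k + r * closeness u y + t * closeness v y <= sc y) ->
  ((k + r * mean_closeness P u + t * mean_closeness P v)%:E
    <= mech_value sc P)%E.
Proof.
move=> P1 msc sc0 hsc; have v0 : (0 <= mech_value sc P)%E.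
  by apply: integral_ge0 => y /= /sc0; rewrite lee_fin.
(* No upper bound on [sc] is assumed, so its integral may be infinite. *)
have [->|vfin] := eqVneq (mech_value sc P) +oo%E; first exact: leey.
have isc : P.-integrable `[0, 1]%classic (EFin \o sc).
  apply/integrableP; split; first exact/measurable_EFinP.
  rewrite (_ : (\int[P]_(x in _) _)%E = mech_value sc P) ?ltey //.
  apply: eq_integral => y /[!inE] /= /sc0 y0.
  by rewrite ger0_norm.
rewrite -Rintegral_closeness_comb // -[mech_value _ _]fineK; last first.
  exact: integrable_fin_num.
rewrite lee_fin; apply: le_Rintegral => //.
exact: integrable_closeness_comb.
Qed.

(* [reflect01 true] is the symmetry of the model exchanging the two endpoints. *)
Definition reflect01 (R : realType) (s : bool) (y : R) : R :=
  if s then 1 - y else y.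

Lemma reflect01_in (R : realType) s (y : R) :
  y \in `[0, 1] -> reflect01 s y \in `[0, 1].
Proof. by case: s => // /itv01P hy; apply/itv01P => /=; lra. Qed.

Lemma reflect01K (R : realType) s : involutive (@reflect01 R s).
Proof. by case: s => y //=; rewrite subKr. Qed.

Lemma closeness_reflect01 (R : realType) s (u y : R) :
  closeness (reflect01 s u) y = closeness u (reflect01 s y).
Proof.
case: s => //; rewrite /closeness /= -normrN; congr (1 - `|_|); ring.
Qed.

(** * Social costs and their optima *)

(** The bound [m] also makes the set of costs bounded below; otherwise [inf] would return a default
    value. *)
Lemma opt_costP (R : realType) (g : R -> R) (m y : R) :
  (forall z, z \in `[0, 1] -> m <= g z) -> y \in `[0, 1] ->
  m <= opt_cost g <= g y.
Proof.
move=> hm hy; apply/andP; split.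
  apply: lb_le_inf; first by exists (g y), y.
  by move=> _ [z hz <-]; exact: hm.
apply: ge_inf; last by exists y.
by exists m => _ [z hz <-]; exact: hm.
Qed.

(** An interface through which all the [sc_p] and [sc_inf] are treated by a single argument. *)
Record regular_cost (R : realType) (sc : forall n, R -> ('I_n -> R) -> R) :=
  RegularCost {
    measurable_cost : forall n (x : 'I_n -> R),
      measurable_fun (`[0, 1]%classic : set R) (fun y => sc n y x);
    closeness_le_cost : forall n (x : 'I_n -> R) y i,
      (forall j, 0 <= closeness (x j) y) -> closeness (x i) y <= sc n y x;
    cost_single : forall n (x : 'I_n -> R) y i,
      (forall j, j != i -> closeness (x j) y = 0) ->
      0 <= closeness (x i) y -> sc n y x = closeness (x i) y }.

Lemma sc_p_regular (R : realType) (p : R) :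
  1 <= p -> regular_cost (fun n y (x : 'I_n -> R) => sc_p p y x).
Proof.
move=> p1; have p0 : p != 0 by rewrite gt_eqF //; lra.
have pK (u : R) : 0 <= u -> (u `^ p) `^ p^-1 = u.
  by move=> u0; rewrite -powRrM mulfV // powRr1.
split=> [n x|n x y i x0|n x y i x0 xi0].
- apply: (measurableT_comp (measurable_powR _)).
  apply: measurable_sum => i.
  by apply: (measurableT_comp (measurable_powR _)); exact: measurable_closeness.
- rewrite -[leLHS]pK // /sc_p; apply: ge0_ler_powR.
  + by rewrite invr_ge0; lra.
  + by rewrite nnegrE powR_ge0.
  + by rewrite nnegrE sumr_ge0 // => j _; exact: powR_ge0.
  by rewrite (bigD1 i) //= lerDl sumr_ge0 // => j _; exact: powR_ge0.
(* Here [p != 0] matters, because [powR] sends [0] with exponent [0] to [1]. *)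
rewrite /sc_p (bigD1 i) //= big1 ?addr0 ?pK // => j /x0 ->.
by rewrite powR0.
Qed.

Lemma sc_inf_regular (R : realType) :
  regular_cost (fun n y (x : 'I_n -> R) => sc_inf y x).
Proof.
split=> [n x|n x y i x0|n x y i x0 xi0].
- rewrite /sc_inf; elim: (index_enum _) => [|i s ihs].
    rewrite [X in measurable_fun _ X](_ : _ = cst 0); first exact: measurable_cst.
    by apply/funext => y; rewrite big_nil.
  rewrite [X in measurable_fun _ X](_ : _ = closeness (x i) \max
    (fun y => \big[Num.max/0]_(k <- s) closeness (x k) y)).
    by apply: measurable_maxr => //; exact: measurable_closeness.
  by apply/funext => y; rewrite big_cons.
- exact: le_bigmax.
apply/le_anti/andP; split; last exact: le_bigmax.
apply/bigmax_leP; split=> // j _.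
by have [->|/x0 ->] := eqVneq j i.
Qed.

(** Up to reflection, a facility at 1 costs the agent at 0 nothing and the agent at [v] exactly [v].
    Positivity holds because the agent at [v] always pays at least [min v (1 - v)]. *)
Lemma opt_cost_pair (R : realType) (sc : forall n, R -> ('I_n -> R) -> R)
    s (i j : 'I_2) (v : R) :
  regular_cost sc -> j != i -> 0 < v < 1 ->
  0 < opt_cost (fun y => sc 2%N y (upd (fun=> reflect01 s v) i (reflect01 s 0)))
  <= v.
Proof.
move=> rsc ji /andP[v0 v1]; set x := upd _ _ _.
have xi : x i = reflect01 s 0 by rewrite /x /upd eqxx.
have xj k : k != i -> x k = reflect01 s v by rewrite /x /upd => /negPf ->.
have i01 (z : R) : 0 <= z <= 1 -> reflect01 s z \in `[0, 1].
  by move=> /itv01P; exact: reflect01_in.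
have x01 k : x k \in `[0, 1].
  by have [->|/xj ->] := eqVneq k i; rewrite ?xi; apply: i01; lra.
have scxj y : y \in `[0, 1] -> Num.min v (1 - v) <= sc 2%N y x.
  move=> y01; apply: le_trans (closeness_le_cost rsc j _); last first.
    by move=> k; exact: closeness_ge0.
  rewrite xj // closeness_reflect01 /closeness.
  have /itv01P hz := reflect01_in s y01.
  have mv : Num.min v (1 - v) <= v by rewrite ge_min lexx.
  have mv' : Num.min v (1 - v) <= 1 - v by rewrite ge_min lexx orbT.
  by rewrite lerBrDl -lerBrDr ler_norml; lra.
have /(opt_costP scxj) : reflect01 s (1 : R) \in `[0, 1] by apply: i01; lra.
have c1 : closeness (x j) (reflect01 s 1) = v.
  rewrite xj // closeness_reflect01 reflect01K /closeness ler0_norm; lra.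
have c0 k : k != j -> closeness (x k) (reflect01 s 1) = 0.
  move=> kj; rewrite (ord2_neq kj (_ : i != j)) 1?eq_sym // xi.
  by rewrite closeness_reflect01 reflect01K /closeness sub0r normrN1 subrr.
rewrite (cost_single rsc c0) c1 ?(ltW v0) // => /andP[ho ->].
by rewrite andbT (lt_le_trans _ ho) // lt_min v0; lra.
Qed.

(** * The bound 5/4 from two agents *)

(** By contradiction: ratio [c] is assumed on all two-agent profiles, then applied at [(0, e)] to
    control the deviation and at [(0, b)] to conclude. The parameters [s], [i], [j] let either agent
    play the left one. *)
Lemma ratio_bound_from_left_agent (R : realType) (f : mechanism R)
    (sc : forall n, R -> ('I_n -> R) -> R) (c h : R) s (i j : 'I_2) :
  valid_mechanism f -> strategyproof f -> regular_cost sc -> j != i ->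
  0 < h -> h <= 1 / 10 -> 4 * h <= 5 / 4 - c ->
  1 / 2 <= mean_closeness
    (f 2%N (upd (fun=> reflect01 s (1 / 2 + h)) i (reflect01 s (1 / 2 - h))))
    (reflect01 s (1 / 2 - h)) ->
  exists n (x : 'I_n -> R), profile_in01 x /\
    0 < opt_cost (fun z => sc n z x) /\
    ((c * opt_cost (fun z => sc n z x))%:E < mech_value (fun y => sc n y x) (f n x))%E.
Proof.
move=> fV fS rsc ji h0 h1 hc meana; apply: contrapT => noex.
(* The misreport [e] is of smaller order than [h], since its error is later multiplied by [l + 1],
   which is about [1 / (8 * h)]. *)
set a := 1 / 2 - h; set b := 1 / 2 + h; set e := h ^+ 2.
have eh : e <= h / 10 by rewrite /e expr2; nra.
have e0 : 0 < e by rewrite exprn_gt0.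
have value_le (x : 'I_2 -> R) : profile_in01 x ->
    0 < opt_cost (fun z => sc 2%N z x) ->
    (mech_value (fun y => sc 2%N y x) (f 2%N x)
      <= (c * opt_cost (fun z => sc 2%N z x))%:E)%E.
  move=> x01 opt0; rewrite leNgt; apply/negP => lt_value.
  by apply: noex; exists 2%N, x.
have in0 : 0 <= (0 : R) <= 1 by lra.
have ina : 0 <= a <= 1 by rewrite /a; lra.
have inb : 0 <= b <= 1 by rewrite /b; lra.
have ine : 0 <= e <= 1 by lra.
have i01 (z : R) : 0 <= z <= 1 -> reflect01 s z \in `[0, 1].
  by move=> /itv01P; exact: reflect01_in.
pose pair u v : 'I_2 -> R := upd (fun=> reflect01 s v) i (reflect01 s u).
have pair01 u v : 0 <= u <= 1 -> 0 <= v <= 1 -> profile_in01 (pair u v).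
  by move=> hu hv k; rewrite /pair /upd; case: ifP => _; exact: i01.
have pairi u v : pair u v i = reflect01 s u by rewrite /pair /upd eqxx.
have pairj u v : pair u v j = reflect01 s v.
  by rewrite /pair /upd (negPf ji).
have pair_ge0 u v y k : 0 <= u <= 1 -> 0 <= v <= 1 -> y \in `[0, 1] ->
    0 <= closeness (pair u v k) y.
  by move=> hu hv y01; apply: closeness_ge0 => //; exact: pair01.
have f1 u v : 0 <= u <= 1 -> 0 <= v <= 1 ->
    f 2%N (pair u v) `[0, 1]%classic = 1%E.
  by move=> hu hv; apply: fV; exact: pair01.
have move_i u u' v : upd (pair u v) i (reflect01 s u') = pair u' v.
  by apply/funext => k; rewrite /pair /upd; case: eqP.
have move_j u v v' : upd (pair u v) j (reflect01 s v') = pair u v'.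
  apply/funext => k; rewrite /pair /upd.
  have [->|kj] := eqVneq k j; first by rewrite (negPf ji).
  by rewrite (ord2_neq kj (_ : i != j)) 1?eq_sym // eqxx.
have mean_i : 1 / 2 <= mean_closeness (f 2%N (pair 0 b)) (reflect01 s a).
  apply: le_trans meana _; rewrite -lee_fin -!exp_costE.
  have := fS 2%N (pair a b) i (reflect01 s 0); rewrite pairi move_i; apply.
    exact: pair01.
  exact: i01.
(* The optimum is at most [e] and [c < 2], so the facility must be near the end opposite to 0. *)
have mean_0 : mean_closeness (f 2%N (pair 0 e)) (reflect01 s 0) <= 2 * e.
  have e1 : 0 < e < 1 by lra.
  have /andP[opt0 oe] := opt_cost_pair s rsc ji e1.
  have e01 : profile_in01 (pair 0 e) by exact: pair01.
  have := value_le _ e01 opt0.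
  have := @mech_value_ge _ (f 2%N (pair 0 e)) (fun y => sc 2%N y (pair 0 e))
    0 1 0 (reflect01 s 0) (reflect01 s 0) _ (measurable_cost rsc _).
  rewrite add0r mul0r addr0 mul1r => le_mean le_opt.
  rewrite -lee_fin; apply: le_trans (le_mean _ _ _) _.
  - exact: f1.
  - move=> y y01; apply: le_trans (closeness_le_cost rsc i _).
      exact: pair_ge0.
    by move=> k; exact: pair_ge0.
  - move=> y y01; rewrite add0r mul0r addr0 mul1r -(pairi 0 e).
    apply: (closeness_le_cost rsc) => k.
    exact: pair_ge0.
  apply: le_trans le_opt _; rewrite lee_fin; nra.
have mean_j : mean_closeness (f 2%N (pair 0 b)) (reflect01 s b) <= b + 2 * e.
  (* Triangle inequality: being close to [b] exceeds being close to 0 by at most [b]. *)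
  have le_b0 : - b <= 1 * mean_closeness (f 2%N (pair 0 e)) (reflect01 s 0)
      + (-1) * mean_closeness (f 2%N (pair 0 e)) (reflect01 s b).
    apply: mean_closeness_comb_ge; first exact: f1.
    move=> y y01; rewrite !closeness_reflect01 /closeness.
    have /itv01P hz := reflect01_in s y01.
    rewrite sub0r normrN ger0_norm; last by lra.
    have := ler_norm (reflect01 s y - b); rewrite distrC; lra.
  have sp_j : mean_closeness (f 2%N (pair 0 b)) (reflect01 s b)
      <= mean_closeness (f 2%N (pair 0 e)) (reflect01 s b).
    rewrite -lee_fin -!exp_costE.
    have := fS 2%N (pair 0 b) j (reflect01 s e); rewrite pairj move_j; apply.
      exact: pair01.
    exact: i01.
  lra.
have b1 : 0 < b < 1 by rewrite /b; lra.
have /andP[opt0 ob] := opt_cost_pair s rsc ji b1.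
have b01 : profile_in01 (pair 0 b) by exact: pair01.
have := value_le _ b01 opt0; apply/negP; rewrite -ltNge.
(* Dual multiplier of [mean_i]; that of [mean_j] is [l + 1]. *)
pose l := (1 / 8 - 3 / 4 * h) / h.
have lh : l * h = 1 / 8 - 3 / 4 * h by rewrite /l divfK // gt_eqF.
have l0 : 0 <= l by rewrite -(pmulr_lge0 _ h0) lh; lra.
have cost_ge y : y \in `[0, 1] ->
    Num.max (closeness (reflect01 s 0) y) (closeness (reflect01 s b) y)
    <= sc 2%N y (pair 0 b).
  move=> y01; rewrite ge_max -{1}(pairi 0 b) -(pairj 0 b).
  by apply/andP; split; apply: closeness_le_cost => // k; exact: pair_ge0.
have := @mech_value_ge _ (f 2%N (pair 0 b)) (fun y => sc 2%N y (pair 0 b))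
  (b + (l + 1) * b - l * a) l (- (l + 1)) (reflect01 s a) (reflect01 s b)
  _ (measurable_cost rsc _).
move=> value_ge; apply: lt_le_trans (value_ge _ _ _).
(* The certificate yields at least [5/8 + h/4 - 2 * (l + 1) * e]. The error term is at most
   [h/4 + h^2/2], which leaves [5/8 - h^2/2], while [c * b] is at most [5/8 - 3/4 * h] for positive
   [c]. *)
- rewrite lte_fin.
  have lae : (l + 1) * e <= h / 8 - 3 / 4 * h ^+ 2 + h ^+ 2.
    by rewrite /e mulrDl mul1r expr2 mulrA lh; lra.
  have cb : c * opt_cost (fun z => sc 2%N z (pair 0 b)) < 5 / 8 - h ^+ 2 / 2.
    have [c0|c0] := leP c 0.
      have := mulr_ge0_le0 (ltW opt0) c0; rewrite mulrC -/e; lra.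
    have := ler_wpM2l (ltW c0) ob; rewrite -/e.
    have := ler_wpM2r (ltW h0) (_ : c <= 5 / 4); rewrite /b; lra.
  have := ler_wpM2l l0 mean_i.
  have := ler_wpM2l (_ : 0 <= l + 1) mean_j.
  move: cb lae lh; rewrite -/e /a /b; lra.
- exact: f1.
- move=> y y01; apply: le_trans (closeness_le_cost rsc i _).
    exact: pair_ge0.
  by move=> k; exact: pair_ge0.
move=> y y01; apply: le_trans (cost_ge y y01).
rewrite !closeness_reflect01; apply: max_closeness_lower_bound => //.
exact: reflect01_in.
Qed.

Lemma ratio_at_least_5_4 (R : realType) (f : mechanism R)
    (sc : forall n, R -> ('I_n -> R) -> R) :
  valid_mechanism f -> strategyproof f -> regular_cost sc ->
  ratio_at_least f sc (5 / 4).
Proof.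
move=> fV fS rsc c hc.
pose h := Num.min (1 / 10) ((5 / 4 - c) / 4).
have h0 : 0 < h by rewrite lt_min; apply/andP; split; lra.
have h1 : h <= 1 / 10 by rewrite ge_min lexx.
have h2 : 4 * h <= 5 / 4 - c.
  have : h <= (5 / 4 - c) / 4 by rewrite ge_min lexx orbT.
  lra.
set a := 1 / 2 - h; set b := 1 / 2 + h.
pose x : 'I_2 -> R := upd (fun=> b) ord0 a.
(* The same profile with the agent at [b] singled out, as the reflected case requires. *)
have xE : x = upd (fun=> a) ord_max b.
  by apply/funext; case=> [[|[|k]] ?].
have : 1 <= 1 * mean_closeness (f 2%N x) a + 1 * mean_closeness (f 2%N x) b.
  apply: mean_closeness_comb_ge => [|y /itv01P hy].
    apply: fV => k; apply/itv01P.
    by rewrite /x /upd /a /b; case: ifP; lra.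
  rewrite !mul1r /closeness.
  have : `|a - y| + `|b - y| <= 1; last by lra.
  have [ya|ya] := leP y a.
    by rewrite !ger0_norm; move: ya; rewrite /a /b; lra.
  have [yb|yb] := leP y b.
    by rewrite ler0_norm ?ger0_norm; move: ya yb; rewrite /a /b; lra.
  by rewrite !ler0_norm; move: ya yb; rewrite /a /b; lra.
rewrite !mul1r => mean_ab.
have [ha|ha] := leP (1 / 2) (mean_closeness (f 2%N x) a).
  exact: (ratio_bound_from_left_agent (s := false) (i := ord0) (j := ord_max)
    fV fS rsc _ h0 h1 h2 ha).
(* The closeness values at [a] and [b] sum to at least 1, so now the agent at [b] has mean at least
   1/2; reflection makes it the left agent. *)
apply: (ratio_bound_from_left_agent (s := true) (i := ord_max) (j := ord0)
  fV fS rsc _ h0 h1 h2) => //=.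
have -> : 1 - (1 / 2 + h) = a by rewrite /a; lra.
have -> : 1 - (1 / 2 - h) = b by rewrite /b; lra.
by rewrite -xE; lra.
Qed.

Lemma ratio_at_least_le (R : realType) (f : mechanism R)
    (sc : forall n, R -> ('I_n -> R) -> R) (c0 c1 : R) :
  c0 <= c1 -> ratio_at_least f sc c1 -> ratio_at_least f sc c0.
Proof. by move=> c01 hf c lt_c; apply: hf; exact: lt_le_trans c01. Qed.

Theorem theorem13 (R : realType) (f : mechanism R) :
  valid_mechanism f -> strategyproof f ->
  (forall p : R, 1 <= p ->
     ratio_at_least f (fun n y x => sc_p p y x) ((5 / 4) `^ (p^-1)))
  /\ ratio_at_least f (fun n y x => sc_inf y x) (1008 / 1000).
Proof.
move=> fV fS; split=> [p p1|].
  apply: ratio_at_least_le (ratio_at_least_5_4 fV fS (sc_p_regular p1)).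
  rewrite -[leRHS]powRr1; last by lra.
  by apply: ler_powR; [lra | rewrite invf_le1; lra].
(* The maximum cost also gets the full bound 5/4, which exceeds 1.008. *)
by apply: ratio_at_least_le (ratio_at_least_5_4 fV fS (sc_inf_regular R)); lra.
Qed.
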